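(* Every connected cograph $G$ has a spanning even tree, unless $G$ is isomorphic to the balanced complete bipartite graph $K_{t,t}$ for some $t \ge 1$.
   Context: All graphs are finite and simple. Cographs are defined inductively: a single-vertex graph is a cograph; the disjoint union of two vertex-disjoint cographs is a cograph; and the complete join $G_1 \Join G_2$ of two vertex-disjoint cographs $G_1=(V_1,E_1)$, $G_2=(V_2,E_2)$, i.e. the graph on $V_1\cup V_2$ with edge set $E_1\cup E_2\cup\{\{u,v\}: u\in V_1, v\in V_2\}$, is a cograph. A leaf of a tree is a vertex of degree $1$. A tree is even if for every pair of distinct leaves, the number of edges of the unique path between them is even. A spanning even tree of $G$ is a spanning tree of $G$ that is even. *)

(* Defs.v *)
From HB Require Import structures.
From mathcomp Require Import all_boot.

Set Implicit Arguments.
Unset Strict Implicit.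
Unset Printing Implicit Defensive.

Record sgraph (V : finType) := SGraph {
  adj :> rel V;
  adj_sym : symmetric adj;
  adj_irr : irreflexive adj }.

Definition isomorphic (V W : finType) (G : sgraph V) (H : sgraph W) : Prop :=
  exists2 f : V -> W, bijective f & forall x y, H (f x) (f y) = G x y.

Section Operations.
Variables V1 V2 : finType.

Definition union_rel (G1 : sgraph V1) (G2 : sgraph V2) : rel (V1 + V2) :=
  fun x y => match x, y with
  | inl a, inl b => G1 a b
  | inr a, inr b => G2 a b
  | _, _ => false
  end.

Lemma union_sym G1 G2 : symmetric (union_rel G1 G2).
Proof. by move=> [a|a] [b|b] //=; apply: adj_sym. Qed.

Lemma union_irr G1 G2 : irreflexive (union_rel G1 G2).
Proof. by move=> [a|a] /=; apply: adj_irr. Qed.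

Definition disjoint_union G1 G2 : sgraph (V1 + V2)%type :=
  SGraph (@union_sym G1 G2) (@union_irr G1 G2).

Definition join_rel (G1 : sgraph V1) (G2 : sgraph V2) : rel (V1 + V2) :=
  fun x y => match x, y with
  | inl a, inl b => G1 a b
  | inr a, inr b => G2 a b
  | _, _ => true
  end.

Lemma join_sym G1 G2 : symmetric (join_rel G1 G2).
Proof. by move=> [a|a] [b|b] //=; apply: adj_sym. Qed.

Lemma join_irr G1 G2 : irreflexive (join_rel G1 G2).
Proof. by move=> [a|a] /=; apply: adj_irr. Qed.

Definition complete_join G1 G2 : sgraph (V1 + V2)%type :=
  SGraph (@join_sym G1 G2) (@join_irr G1 G2).

Definition bipartite_rel : rel (V1 + V2) :=
  fun x y => match x, y with
  | inl _, inr _ | inr _, inl _ => true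
  | _, _ => false
  end.

Lemma bipartite_sym : symmetric bipartite_rel.
Proof. by move=> [a|a] [b|b]. Qed.

Lemma bipartite_irr : irreflexive bipartite_rel.
Proof. by move=> [a|a]. Qed.

Definition complete_bipartite : sgraph (V1 + V2)%type :=
  SGraph bipartite_sym bipartite_irr.

End Operations.

Definition Kbip (m n : nat) : sgraph ('I_m + 'I_n)%type :=
  complete_bipartite 'I_m 'I_n.

(* Vertex-disjointness of the two operands is realised by the sum type;
   [cograph_iso] transports the result to an arbitrary vertex type. *)
Inductive cograph : forall V : finType, sgraph V -> Prop :=
| cograph_single (V : finType) (G : sgraph V) : #|V| = 1 -> cograph G
| cograph_union (V1 V2 : finType) (G1 : sgraph V1) (G2 : sgraph V2) :
    cograph G1 -> cograph G2 -> cograph (disjoint_union G1 G2)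
| cograph_join (V1 V2 : finType) (G1 : sgraph V1) (G2 : sgraph V2) :
    cograph G1 -> cograph G2 -> cograph (complete_join G1 G2)
| cograph_iso (V W : finType) (G : sgraph V) (H : sgraph W) :
    isomorphic G H -> cograph G -> cograph H.

Section Trees.
Variable V : finType.
Implicit Types G T : sgraph V.

Definition connected G : Prop := 0 < #|V| /\ forall x y, connect G x y.

(* [ucycle] alone would also accept a single edge traversed back and forth. *)
Definition acyclic G : Prop := forall c : seq V, 2 < size c -> ~ ucycle G c.

Definition is_tree T : Prop := connected T /\ acyclic T.

Definition degree G (x : V) : nat := #|[set y | G x y]|.

Definition leaf T (x : V) : Prop := degree T x = 1.

(* The path has vertex sequence [x :: p], hence [size p] edges; in a tree
   there is exactly one such [p] for given ends. *)
Definition even_tree T : Prop :=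
  is_tree T /\
  forall x y : V, leaf T x -> leaf T y -> x <> y ->
    forall p : seq V, path T x p -> uniq (x :: p) -> last x p = y ->
      ~~ odd (size p).

Definition spanning_even_tree G T : Prop := subrel T G /\ even_tree T.

End Trees.

(* Main.v *)
Require Import Defs.
From HB Require Import structures.
From mathcomp Require Import all_boot.

(** A tree is even iff all its leaves lie in one class of its bipartition, that
    is, iff every vertex of the other class has degree at least 2.

    A connected cograph with more than one vertex is a join of two nonempty
    sides [A] and [B].  If [#|B| < #|A|], a path that alternates between the
    sides, starts and ends in [A] and exhausts [B], with the remaining vertices
    of [A] hung on [B], is a spanning even tree.  If [#|A| = #|B|] and [u v] is
    an edge inside [A], let the path alternate between [B] and [A :\ u], and
    hang [u] on [v].  If neither side has an inner edge, the graph is balanced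
    complete bipartite. *)

Set Implicit Arguments.
Unset Strict Implicit.
Unset Printing Implicit Defensive.

(** * Rooted trees encoded by a parent map *)

Section ParentTree.

Variables (V : finType) (r : V) (f : V -> V) (h : V -> nat).
Hypothesis h_parent : forall x, x != r -> h (f x) < h x.

(** The rank [h] drops along [f], so every chain of parents ends at [r]. The guards discard the
    value of [f] at the root. *)
Definition parent_rel : rel V :=
  fun x y => (x != r) && (f x == y) || (y != r) && (f y == x).

Lemma parent_sym : symmetric parent_rel.
Proof. by move=> x y; rewrite /parent_rel orbC. Qed.

Lemma parent_irr : irreflexive parent_rel.
Proof.
move=> x; rewrite /parent_rel orbb; apply/negP => /andP[/h_parent hx /eqP fx].
by rewrite fx ltnn in hx.
Qed.

Definition parent_graph : sgraph V := SGraph parent_sym parent_irr.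

Lemma parent_edge x : x != r -> parent_graph x (f x).
Proof. by move=> xr; rewrite /= /parent_rel xr eqxx. Qed.

Lemma parent_connected : connected parent_graph.
Proof.
split; first by apply/card_gt0P; exists r.
have to_root x : connect parent_graph x r.
  have [n] := ubnP (h x); elim: n x => // n IHn x hx.
  have [-> | xr] := eqVneq x r; first exact: connect0.
  apply: (@connect_trans _ _ (f x)); first exact: connect1 (parent_edge xr).
  exact: IHn (leq_trans (h_parent xr) hx).
move=> x y; apply: connect_trans (to_root x) _.
by rewrite (sym_connect_sym parent_sym).
Qed.

(* In a cycle, both neighbours of a vertex of maximal rank are its parent. *)
Lemma parent_acyclic : acyclic parent_graph.
Proof.
move=> c c3 /andP[cyc_c uniq_c].
have [x0 x0c] : exists x, x \in c.
  by case: c c3 {cyc_c uniq_c} => // x c; exists x; rewrite mem_head.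
have [x xc x_max] := @arg_maxnP _ x0 (mem c) h x0c.
have max_nbr y : y \in c -> parent_graph x y -> y = f x.
  move=> yc /orP[/andP[_ /eqP->] // | /andP[/h_parent hy /eqP fy]].
  by have := leq_trans hy (x_max _ yc); rewrite fy ltnn.
have [i p def_c] := rot_to xc.
have size_c : size (x :: p) = size c by rewrite -def_c size_rot.
move: cyc_c uniq_c; rewrite -(rot_cycle i) -(rot_uniq i) def_c.
have in_c y : y \in p -> y \in c.
  by move=> yp; rewrite -(mem_rot i) def_c inE yp orbT.
(* As [c] has at least three vertices, [y] and [last z p] are distinct neighbours of [x] on the
   cycle. *)
case: p {def_c} size_c in_c => [|y [|z p]] size_c in_c;
  [by rewrite -size_c in c3.. |].
rewrite /= rcons_path => /and3P[xy _ /andP[_ last_x]] /and4P[_ yNzp _ _].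
have eq_y : y = f x by apply: max_nbr xy; rewrite in_c ?mem_head.
have eq_last : last z p = f x.
  by apply: max_nbr; [rewrite in_c // inE mem_last orbT | rewrite adj_sym].
by rewrite eq_y -eq_last mem_last in yNzp.
Qed.

(** Every edge joins a vertex to its parent, so [c] is a proper 2-colouring. All leaves have colour
    [false], and a path between vertices of equal colour has even length. *)
Lemma parent_even (c : V -> bool) :
    (forall x, x != r -> c (f x) = ~~ c x) ->
    (forall x, c x -> 1 < degree parent_graph x) ->
  even_tree parent_graph.
Proof.
move=> c_parent c_deg; split.
  by split; [exact: parent_connected | exact: parent_acyclic].
have c_edge x y : parent_graph x y -> c y = ~~ c x.
  by case/orP=> /andP[/c_parent cf /eqP<-]; rewrite cf ?negbK.
have c_leaf x : leaf parent_graph x -> c x = false.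
  by move=> x1; apply/negP => /c_deg; rewrite x1.
have c_path p x : path parent_graph x p -> c (last x p) = c x (+) odd (size p).
  elim: p x => [|y p IHp] x /=; first by rewrite addbF.
  by case/andP=> /c_edge cy /IHp->; rewrite cy addbN addNb.
move=> x y /c_leaf cx /c_leaf cy _ p /c_path + _ lastp.
by rewrite lastp cx cy addFb => <-.
Qed.

End ParentTree.

(** * Even trees from alternating paths *)

(* The tree is the path [x_0 y_0 x_1 y_1 ... y_k.-1 x_k], with every vertex
   outside it hung on one of the [y_i]. *)
Lemma zigzag_spanning_even_tree (V : finType) (G : sgraph V) (xs ys : seq V) :
    size xs = (size ys).+1 -> uniq (xs ++ ys) ->
    {in xs & ys, forall x y, G x y} ->
    (forall z, z \notin xs -> z \notin ys -> exists2 y, y \in ys & G z y) ->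
  exists T : sgraph V, spanning_even_tree G T.
Proof.
move=> size_xs; rewrite cat_uniq => /and3P[uniq_xs /hasPn disj uniq_ys] Gxy Gz.
have [r r_xs] : exists r, r = nth r xs 0.
  by case: xs size_xs {uniq_xs disj Gxy Gz} => // r xs; exists r.
have disjx x : x \in xs -> x \notin ys by apply: contraL => /disj.
pose g z := odflt r [pick y in ys | G z y].
have gP z : z \notin xs -> z \notin ys -> g z \in ys /\ G z (g z).
  move=> zx zy; rewrite /g; case: pickP => [y /andP[] // | none].
  by have [y yys Gzy] := Gz z zx zy; move: (none y); rewrite yys Gzy.
(* Rooted at [x_0]: the parent of [y_i] is [x_i], that of [x_i.+1] is [y_i], and a vertex off the
   path hangs on [g z]. *)
pose f z := if z \in ys then nth r xs (index z ys)
            else if z \in xs then nth r ys (index z xs).-1 else g z.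
(* The rank is the position on the path; vertices off it get a rank above that of every [y_i]. *)
pose h z := if z \in ys then (index z ys).*2.+1
            else if z \in xs then (index z xs).*2 else (size ys).*2.+1.
have fP z : z != r -> [/\ h (f z) < h z, (f z \in ys) = (z \notin ys) & G z (f z)].
  move=> zr; rewrite /f; case: ifPn => [zy | zNy].
    have iy : index z ys < size xs by rewrite size_xs ltnS index_size.
    have fx : nth r xs (index z ys) \in xs by rewrite mem_nth.
    rewrite /h (negPf (disjx _ fx)) fx zy index_uniq // ltnS leqnn.
    by split=> //; rewrite adj_sym; exact: Gxy.
  case: ifPn => [zx | zNx]; last first.
    have [gy Gg] := gP z zNx zNy; rewrite /h gy (negPf zNy) (negPf zNx).
    by split=> //; rewrite ltnS ltn_double index_mem.
  have ix0 : 0 < index z xs.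
    rewrite lt0n; apply: contra zr => /eqP ix.
    by rewrite r_xs -ix nth_index.
  have ix : (index z xs).-1 < size ys.
    by rewrite -ltnS prednK // -size_xs index_mem.
  have fy : nth r ys (index z xs).-1 \in ys by rewrite mem_nth.
  rewrite /h fy (negPf zNy) zx index_uniq //; split=> //; last exact: Gxy.
  by rewrite -{2}(prednK ix0) doubleS.
have hf z : z != r -> h (f z) < h z by case/fP.
exists (parent_graph hf); split.
  move=> x y /orP[] /andP[/fP[_ _ Gf] /eqP<-] //; by rewrite adj_sym.
apply: (@parent_even _ _ _ _ _ (mem ys)) => /= [x /fP[] // | y yys].
have iy : index y ys < size ys by rewrite index_mem.
have ryN : r \notin ys by apply: disjx; rewrite r_xs mem_nth // size_xs.
have yr : y != r by apply: contraNneq ryN => <-.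
(* [y_i] has two distinct neighbours: its parent [x_i] and its child [x_i.+1]. *)
pose x1 := nth r xs (index y ys); pose x2 := nth r xs (index y ys).+1.
have x2xs : x2 \in xs by rewrite mem_nth // size_xs ltnS.
have x12 : x1 != x2 by rewrite nth_uniq ?size_xs ?ltnS ?(ltnW iy) // neq_ltn ltnSn.
have fx2 : f x2 = y.
  by rewrite /f (negPf (disjx _ x2xs)) x2xs index_uniq ?size_xs ?ltnS // nth_index.
have x2r : x2 != r by rewrite {1}r_xs nth_uniq ?size_xs ?ltnS.
apply: leq_trans (subset_leq_card (_ : [set x1; x2] \subset _)).
  by rewrite cards2 x12.
apply/subsetP => z; rewrite !inE => /orP[] /eqP->; rewrite /= /parent_rel.
  by rewrite yr {1}/f yys eqxx.
by rewrite x2r fx2 eqxx orbT.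
Qed.

Lemma unbalanced_join_tree (V : finType) (G : sgraph V) (A B : {set V}) :
    B = ~: A -> B != set0 -> #|B| < #|A| ->
    {in A & B, forall x y, G x y} ->
  exists T : sgraph V, spanning_even_tree G T.
Proof.
move=> defB /set0Pn[b bB] ltBA GAB.
have inA x : x \in take #|B|.+1 (enum A) -> x \in A.
  by move/mem_take; rewrite mem_enum.
(* The path exhausts [B], so any vertex left over lies in [A] and is adjacent to [b]. *)
apply: (@zigzag_spanning_even_tree _ _ (take #|B|.+1 (enum A)) (enum B)).
- by rewrite size_take_min -!cardE; apply/minn_idPl.
- rewrite cat_uniq take_uniq ?enum_uniq //= andbT; apply/hasPn => x.
  by rewrite mem_enum => xB; apply: contraL xB => /inA xA; rewrite defB inE xA.
- by move=> x y /inA xA; rewrite mem_enum => /(GAB _ _ xA).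
- move=> z _; rewrite mem_enum => zB; exists b; first by rewrite mem_enum.
  by apply: GAB => //; rewrite defB inE negbK in zB.
Qed.

Lemma balanced_join_tree (V : finType) (G : sgraph V) (A B : {set V}) u v :
    B = ~: A -> #|A| = #|B| -> {in A & B, forall x y, G x y} ->
    u \in A -> v \in A -> G u v ->
  exists T : sgraph V, spanning_even_tree G T.
Proof.
move=> defB eqAB GAB uA vA Guv.
(* Only [u] is off the path, and [v] is on it because [G] has no loops. *)
apply: (@zigzag_spanning_even_tree _ _ (enum B) (enum (A :\ u))).
- by rewrite -!cardE -eqAB (cardsD1 u A) uA.
- rewrite cat_uniq !enum_uniq /= andbT; apply/hasPn => x.
  by rewrite !mem_enum defB !inE => /andP[_ ->].
- move=> x y; rewrite !mem_enum => xB /setD1P[_ yA].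
  by rewrite adj_sym; exact: GAB.
- move=> z; rewrite !mem_enum defB !inE negbK => zA.
  rewrite zA andbT negbK => /eqP->; exists v => //.
  rewrite mem_enum !inE vA andbT; apply: contraTneq Guv => ->.
  by rewrite adj_irr.
Qed.

(** * Connected cographs as joins, and the exceptional graphs *)

Lemma cograph_card_gt0 (V : finType) (G : sgraph V) : cograph G -> 0 < #|V|.
Proof.
elim=> {V G} [V G -> // | V1 V2 G1 G2 _ c1 _ _ | V1 V2 G1 G2 _ c1 _ _
             | V W G H [f bij_f _] _].
- by rewrite card_sum addn_gt0 c1.
- by rewrite card_sum addn_gt0 c1.
- by rewrite (bij_eq_card bij_f).
Qed.

Lemma connected_iso (V W : finType) (G : sgraph V) (H : sgraph W) :
  isomorphic G H -> connected H -> connected G.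
Proof.
move=> [f bij_f fE] [W0 conH]; split; first by rewrite (bij_eq_card bij_f).
case: bij_f => g gK fK x y.
have /connectP[p Hp] := conH (f x) (f y).
elim: p x Hp => [|w p IHp] x /=; first by move=> _ /(can_inj gK)->.
rewrite -[w]fK fE => /andP[Gx /IHp conn] /conn.
exact: connect_trans (connect1 Gx).
Qed.

Lemma connected_cograph_join (V : finType) (G : sgraph V) :
    cograph G -> connected G ->
  #|V| = 1 \/ exists A : {set V},
    [/\ A != set0, ~: A != set0 & {in A & ~: A, forall x y, G x y}].
Proof.
elim=> {V G} [V G -> | V1 V2 G1 G2 c1 _ c2 _ [_ con] | V1 V2 G1 G2 c1 _ c2 _ _
             | V W G H isoGH _ IH conH].
- by left.
- have /card_gt0P[x _] := cograph_card_gt0 c1.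
  have /card_gt0P[y _] := cograph_card_gt0 c2.
  have /connectP[p] := con (inl x) (inr y).
  (* A path in a disjoint union that starts on the left never reaches the right. *)
  by elim: p x => [|[z|z] p IHp] x //= /andP[_ /IHp].
- have /card_gt0P[x _] := cograph_card_gt0 c1.
  have /card_gt0P[y _] := cograph_card_gt0 c2.
  right; exists [set z : V1 + V2 | if z is inl _ then true else false]; split.
  + by apply/set0Pn; exists (inl x); rewrite inE.
  + by apply/set0Pn; exists (inr y); rewrite !inE.
  + by move=> [a|a] [b|b]; rewrite !inE.
- have [f bij_f fE] := isoGH.
  have [V1 | [A [/set0Pn[x xA] /set0Pn[y yA] GA]]] := IH (connected_iso isoGH conH).
    by left; rewrite -(bij_eq_card bij_f).
  case: bij_f => g gK fK; right; exists (g @^-1: A); split.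
  + by apply/set0Pn; exists (f x); rewrite inE gK.
  + by apply/set0Pn; exists (f y); rewrite !inE gK -in_setC.
  + move=> a b; rewrite !inE => aA bA.
    by rewrite -(fK a) -(fK b) fE GA ?inE.
Qed.

Lemma balanced_join_bipartite (V : finType) (G : sgraph V) (A : {set V}) :
    A != set0 -> #|A| = #|~: A| -> {in A & ~: A, forall x y, G x y} ->
    {in A &, forall x y, G x y = false} ->
    {in ~: A &, forall x y, G x y = false} ->
  isomorphic G (Kbip #|A| #|A|).
Proof.
move=> A0 eqA GA GAA GCC.
have lt1 x : x \in A -> index x (enum A) < #|A| by rewrite cardE index_mem mem_enum.
have lt2 x : x \notin A -> index x (enum (~: A)) < #|A|.
  by rewrite eqA cardE index_mem mem_enum inE.
have cardA : #|A| = #|A|.-1.+1 by rewrite prednK // card_gt0.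
(* [inord] needs an ordinal type whose bound is a successor. *)
rewrite cardA in lt1 lt2 *.
pose f x : 'I_#|A|.-1.+1 + 'I_#|A|.-1.+1 :=
  if x \in A then inl (inord (index x (enum A)))
  else inr (inord (index x (enum (~: A)))).
exists f.
  apply: inj_card_bij; last by rewrite card_sum !card_ord -cardA {2}eqA cardsC.
  move=> x y; rewrite /f; case: ifPn => xA; case: ifPn => yA // [] /(congr1 val) /=.
    rewrite !inordK ?lt1 // => eq_i.
    by apply: (index_inj x) eq_i; rewrite mem_enum.
  rewrite !inordK ?lt2 // => eq_i.
  by apply: (index_inj x) eq_i; rewrite mem_enum inE.
move=> x y; rewrite /f; case: ifPn => xA; case: ifPn => yA /=; symmetry.
- exact: GAA.
- by apply: GA; rewrite ?inE.
- by rewrite adj_sym; apply: GA; rewrite ?inE.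
- by apply: GCC; rewrite inE.
Qed.

Theorem theorem5 (V : finType) (G : sgraph V) :
  cograph G -> connected G ->
  ~ (exists t : nat, 1 <= t /\ isomorphic G (Kbip t t)) ->
  exists T : sgraph V, spanning_even_tree G T.
Proof.
move=> coG conG notK.
have [V1 | [A [A0 B0 GA]]] := connected_cograph_join coG conG.
  have /card1P[x eqx] : #|V| == 1 by rewrite V1.
  (* A single vertex is the path with no [y_i]. *)
  apply: (@zigzag_spanning_even_tree _ _ [:: x] [::]) => // z.
  by rewrite inE; have := eqx z; rewrite !inE => <-.
have GB : {in ~: A & A, forall x y, G x y}.
  by move=> x y xB yA; rewrite adj_sym; exact: GA.
have defA : A = ~: ~: A by rewrite setCK.
(* The sides are interchangeable: [defA] and [GB] let [~: A] take the role of [A]. *)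
have [ltAB | ltBA | eqAB] := ltngtP #|A| #|~: A|.
- exact: unbalanced_join_tree defA A0 ltAB GB.
- exact: unbalanced_join_tree erefl B0 ltBA GA.
have [/exists_inP[u uA /exists_inP[v vA Guv]] | noA] :=
    boolP [exists u in A, exists v in A, G u v].
  exact: balanced_join_tree erefl eqAB GA uA vA Guv.
have [/exists_inP[u uB /exists_inP[v vB Guv]] | noB] :=
    boolP [exists u in ~: A, exists v in ~: A, G u v].
  exact: balanced_join_tree defA (esym eqAB) GB uB vB Guv.
case: notK; exists #|A|; split; first by rewrite card_gt0.
apply: balanced_join_bipartite => // x y xA yA; apply/negP => Gxy.
  by case/exists_inP: noA; exists x => //; apply/exists_inP; exists y.
by case/exists_inP: noB; exists x => //; apply/exists_inP; exists y.
Qed.
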